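(* If $\nu\ge\tfrac32$, then the function $x\mapsto -\mathcal{K}_\nu'(x)$ is strictly log-concave on $(0,\infty)$.
   Context: For $\nu>0$ define $\mathcal{K}_\nu:(0,\infty)\to(0,\infty)$ by $\mathcal{K}_\nu(x)=2^{\nu-1}\Gamma(\nu)x^\nu K_\nu(x)$, where $K_\nu$ is the modified Bessel function of the second kind (MacDonald function). Note $-\mathcal{K}_\nu'(x)=2^{\nu-1}\Gamma(\nu)x^\nu K_{\nu-1}(x)>0$. *)

(* Defs.v *)
From Stdlib Require Import Reals Lra ClassicalEpsilon.
Open Scope R_scope.

Definition improper_integral_0_inf (f : R -> R) (l : R) : Prop :=
  (forall a b, 0 < a -> a <= b -> inhabited (Riemann_integrable f a b)) /\
  (forall eps, 0 < eps -> exists delta B, 0 < delta /\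
     forall a b, 0 < a -> a < delta -> B <= b -> a <= b ->
       exists pr : Riemann_integrable f a b, Rabs (RiemannInt pr - l) < eps).

Definition Int_0_inf (f : R -> R) : R :=
  epsilon (inhabits 0) (fun l => improper_integral_0_inf f l).

Definition Gamma (nu : R) : R :=
  Int_0_inf (fun t => Rpower t (nu - 1) * exp (- t)).

Definition BesselK (nu x : R) : R :=
  Int_0_inf (fun t => exp (- x * cosh t) * cosh (nu * t)).

Definition calK (nu x : R) : R :=
  Rpower 2 (nu - 1) * Gamma nu * Rpower x nu * BesselK nu x.

Definition strictly_log_concave_pos (g : R -> R) : Prop :=
  (forall x, 0 < x -> 0 < g x) /\
  (forall x y t, 0 < x -> 0 < y -> x <> y -> 0 < t < 1 ->
     t * ln (g x) + (1 - t) * ln (g y) < ln (g (t * x + (1 - t) * y))).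

(* Main.v *)
(** Write [A], [B] for the Macdonald functions of orders [nu] and [nu - 1], so
    that the function in question is a positive constant times [x^nu B].  The
    recurrences [A' = - B - (nu/x) A] and [B' = - A + ((nu-1)/x) B] give, with
    [m = 2 nu - 1], [(ln (x^nu B))'' = - F / (x B^2)] where
    [F = x (A^2 - B^2) - m A B + m B^2 / x].  The point is that [F] is monotone:
    [F' = - (m B / x^2) (x A - (m - 2) B) < 0], because
    [x A - (m - 1) B = x K_(nu-2)(x) > 0].  As [F] tends to [0] at infinity,
    [F > 0]. *)

Require Import Defs.
From Stdlib Require Import Reals Lra ClassicalEpsilon.
From Coquelicot Require Import Coquelicot.
Open Scope R_scope.

(** * Improper integrals over the positive half-line *)

(** Trades the integrability proofs carried by [RiemannInt] for the total function [RInt], through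
    which all later integrals are estimated. *)
Lemma improper_integral_RInt (f : R -> R) (l : R) :
  improper_integral_0_inf f l <->
  (forall a b, 0 < a -> a <= b -> ex_RInt f a b) /\
  (forall eps, 0 < eps -> exists delta B, 0 < delta /\
     forall a b, 0 < a -> a < delta -> B <= b -> a <= b ->
       Rabs (RInt f a b - l) < eps).
Proof.
  split; intros [Hi Hl]; split.
  - intros a b Ha Hab. destruct (Hi a b Ha Hab) as [pr].
    now apply ex_RInt_Reals_1.
  - intros eps He. destruct (Hl eps He) as (d & B & Hd & H).
    exists d, B; split; [exact Hd|]. intros a b Ha Hd' HB Hab.
    destruct (H a b Ha Hd' HB Hab) as [pr Hpr].
    now rewrite (RInt_Reals f a b pr).
  - intros a b Ha Hab. constructor. apply ex_RInt_Reals_0. now apply Hi.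
  - intros eps He. destruct (Hl eps He) as (d & B & Hd & H).
    exists d, B; split; [exact Hd|]. intros a b Ha Hd' HB Hab.
    exists (ex_RInt_Reals_0 f a b (Hi a b Ha Hab)).
    rewrite <- RInt_Reals. now apply H.
Qed.

Lemma improper_integral_le (f g : R -> R) (lf lg : R) :
  improper_integral_0_inf f lf -> improper_integral_0_inf g lg ->
  (forall t, 0 < t -> f t <= g t) -> lf <= lg.
Proof.
  intros Hf Hg Hle.
  apply improper_integral_RInt in Hf, Hg.
  destruct Hf as [Fi Fl], Hg as [Gi Gl].
  apply Rnot_lt_le; intros Hlt.
  (* With both truncated integrals within half the gap of their limits on a common interval, their
     order would contradict [RInt_le]. *)
  destruct (Fl ((lf - lg) / 2)) as (d1 & B1 & Hd1 & H1); [lra|].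
  destruct (Gl ((lf - lg) / 2)) as (d2 & B2 & Hd2 & H2); [lra|].
  set (a := Rmin d1 d2 / 2). set (b := Rmax (Rmax B1 B2) a).
  assert (Hd : 0 < Rmin d1 d2) by now apply Rmin_glb_lt.
  pose proof (Rmin_l d1 d2). pose proof (Rmin_r d1 d2).
  pose proof (Rmax_l B1 B2). pose proof (Rmax_r B1 B2).
  pose proof (Rmax_l (Rmax B1 B2) a) as Hb1.
  pose proof (Rmax_r (Rmax B1 B2) a) as Hb2.
  fold b in Hb1, Hb2.
  assert (Ha : 0 < a) by (unfold a; lra).
  assert (Had : a < Rmin d1 d2) by (unfold a; lra).
  assert (K1 := H1 a b Ha ltac:(lra) ltac:(lra) Hb2).
  assert (K2 := H2 a b Ha ltac:(lra) ltac:(lra) Hb2).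
  assert (K : RInt f a b <= RInt g a b).
  { apply RInt_le; auto. intros t Ht; apply Hle; lra. }
  apply Rabs_def2 in K1, K2. lra.
Qed.

Lemma improper_integral_unique (f : R -> R) (l1 l2 : R) :
  improper_integral_0_inf f l1 -> improper_integral_0_inf f l2 -> l1 = l2.
Proof.
  intros H1 H2. apply Rle_antisym; eapply improper_integral_le; eauto;
    intros; apply Rle_refl.
Qed.

(** The value of [Int_0_inf] is chosen by [epsilon], so it means something only once some limit is
    known to exist. *)
Lemma Int_0_inf_correct (f : R -> R) (l : R) :
  improper_integral_0_inf f l -> improper_integral_0_inf f (Int_0_inf f).
Proof.
  intros H. unfold Int_0_inf. apply epsilon_spec. now exists l.
Qed.

Lemma improper_integral_lin (f g h : R -> R) (p q lf lg : R) :
  improper_integral_0_inf f lf -> improper_integral_0_inf g lg ->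
  (forall t, 0 < t -> h t = p * f t + q * g t) ->
  improper_integral_0_inf h (p * lf + q * lg).
Proof.
  intros Hf Hg Hh.
  apply improper_integral_RInt in Hf, Hg. apply improper_integral_RInt.
  destruct Hf as [Fi Fl], Hg as [Gi Gl].
  assert (HI : forall a b, 0 < a -> a <= b ->
            is_RInt h a b (p * RInt f a b + q * RInt g a b)).
  { intros a b Ha Hab.
    apply (is_RInt_ext (fun t => plus (scal p (f t)) (scal q (g t)))).
    - intros t [Ht _]. rewrite Rmin_left in Ht by lra.
      symmetry; apply Hh; lra.
    - apply @is_RInt_plus; apply @is_RInt_scal; apply @RInt_correct; auto. }
  split.
  - intros a b Ha Hab. eexists. now apply HI.
  - intros eps He.
    pose proof (Rabs_pos p). pose proof (Rabs_pos q).
    (* The summand [1] keeps the denominator positive when [p = q = 0]. *)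
    set (e := eps / (Rabs p + Rabs q + 1)).
    assert (Hee : 0 < e) by (apply Rdiv_lt_0_compat; lra).
    assert (Hes : (Rabs p + Rabs q + 1) * e = eps) by (unfold e; field; lra).
    destruct (Fl e Hee) as (d1 & B1 & Hd1 & H1).
    destruct (Gl e Hee) as (d2 & B2 & Hd2 & H2).
    exists (Rmin d1 d2), (Rmax B1 B2).
    split; [now apply Rmin_glb_lt|]. intros a b Ha Had HB Hab.
    pose proof (Rmin_l d1 d2). pose proof (Rmin_r d1 d2).
    pose proof (Rmax_l B1 B2). pose proof (Rmax_r B1 B2).
    rewrite (is_RInt_unique _ _ _ _ (HI a b Ha Hab)).
    replace (p * RInt f a b + q * RInt g a b - (p * lf + q * lg)) with
      (p * (RInt f a b - lf) + q * (RInt g a b - lg)) by ring.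
    eapply Rle_lt_trans; [apply Rabs_triang|]. rewrite !Rabs_mult.
    assert (K1 := H1 a b Ha ltac:(lra) ltac:(lra) Hab).
    assert (K2 := H2 a b Ha ltac:(lra) ltac:(lra) Hab).
    nra.
Qed.

Lemma RInt_le_extend (f : R -> R) (a a0 b0 b : R) :
  0 < a -> a <= a0 -> a0 <= b0 -> b0 <= b ->
  (forall u v, 0 < u -> u <= v -> ex_RInt f u v) ->
  (forall t, 0 < t -> 0 <= f t) ->
  RInt f a0 b0 <= RInt f a b.
Proof.
  intros Ha H1 H2 H3 Hi Hp.
  rewrite <- (RInt_Chasles f a a0 b) by (apply Hi; lra).
  rewrite <- (RInt_Chasles f a0 b0 b) by (apply Hi; lra).
  assert (0 <= RInt f a a0).
  { apply RInt_ge_0; [lra|apply Hi; lra|intros; apply Hp; lra]. }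
  assert (0 <= RInt f b0 b).
  { apply RInt_ge_0; [lra|apply Hi; lra|intros; apply Hp; lra]. }
  unfold plus; simpl. lra.
Qed.

(** For [f >= 0] the truncated integrals grow with the interval and stay below [2 * C], which bounds
    the integrals of the majorant; their supremum is the limit. *)
Lemma improper_integral_exists (f : R -> R) (C : R) :
  (forall t, 0 < t -> continuous f t) ->
  (forall t, 0 < t -> 0 <= f t) ->
  (forall t, 0 < t -> f t <= C * exp (- (t / 2))) ->
  exists l, improper_integral_0_inf f l.
Proof.
  intros Hc Hp HC.
  assert (Hi : forall a b, 0 < a -> a <= b -> ex_RInt f a b).
  { intros a b Ha Hab. apply @ex_RInt_continuous. intros t [Ht _].
    rewrite Rmin_left in Ht by lra. apply Hc; lra. }
  assert (HC0 : 0 <= C).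
  { assert (K := HC 1 Rlt_0_1). assert (K' := Hp 1 Rlt_0_1).
    assert (0 < exp (- (1 / 2))) by apply exp_pos. nra. }
  assert (Hb : forall a b, 0 < a -> a <= b -> RInt f a b <= 2 * C).
  { intros a b Ha Hab.
    assert (HI : is_RInt (fun t => C * exp (- (t / 2))) a b
               (minus (- (2 * C) * exp (- (b / 2)))
                      (- (2 * C) * exp (- (a / 2))))).
    { apply (is_RInt_derive (fun t => - (2 * C) * exp (- (t / 2)))).
      - intros t _. auto_derive; [exact I|unfold Rdiv; field].
      - intros t _. apply @ex_derive_continuous. auto_derive. exact I. }
    apply Rle_trans with (RInt (fun t => C * exp (- (t / 2))) a b).
    - apply RInt_le; [exact Hab|now apply Hi|eexists; exact HI|].
      intros t Ht; apply HC; lra.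
    - rewrite (is_RInt_unique _ _ _ _ HI). unfold minus, plus, opp; simpl.
      assert (0 < exp (- (b / 2))) by apply exp_pos.
      assert (exp (- (a / 2)) < 1).
      { rewrite <- exp_0. apply exp_increasing. lra. }
      nra. }
  destruct (completeness (fun v => exists a b, 0 < a /\ a <= b /\ v = RInt f a b))
    as [l [Hub Hlub]].
  - exists (2 * C). intros v (a & b & Ha & Hab & ->). now apply Hb.
  - exists (RInt f 1 1), 1, 1. repeat split; lra.
  - exists l. apply improper_integral_RInt; split; [exact Hi|].
    intros eps He.
    assert (Hex : exists a b, 0 < a /\ a <= b /\ l - eps < RInt f a b).
    { apply NNPP; intros Hn.
      assert (l <= l - eps); [|lra].
      apply Hlub. intros v (a & b & Ha & Hab & ->).
      apply Rnot_lt_le; intros Hlt. apply Hn. now exists a, b. }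
    destruct Hex as (a0 & b0 & Ha0 & Hab0 & H0).
    exists a0, b0. split; [exact Ha0|]. intros a b Ha Haa0 Hb0 Hab.
    assert (RInt f a b <= l) by (apply Hub; now exists a, b).
    assert (RInt f a0 b0 <= RInt f a b)
      by (apply RInt_le_extend; auto; lra).
    apply Rabs_def1; lra.
Qed.

(** The integral over [[1, 2]] is a positive lower bound for every truncation containing that
    interval. *)
Lemma improper_integral_pos (f : R -> R) (l : R) :
  (forall t, 0 < t -> continuous f t) ->
  (forall t, 0 < t -> 0 < f t) ->
  improper_integral_0_inf f l -> 0 < l.
Proof.
  intros Hc Hp Hf. apply improper_integral_RInt in Hf.
  destruct Hf as [Hi Hl].
  assert (H12 : 0 < RInt f 1 2).
  { apply RInt_gt_0; [lra|intros; apply Hp; lra|intros; apply Hc; lra]. }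
  apply Rnot_le_lt; intros Hle.
  destruct (Hl (RInt f 1 2) H12) as (d & B & Hd & H).
  set (a := Rmin (d / 2) 1). set (b := Rmax B 2).
  assert (Ha : 0 < a) by (apply Rmin_glb_lt; lra).
  pose proof (Rmin_l (d / 2) 1 : a <= d / 2).
  pose proof (Rmin_r (d / 2) 1 : a <= 1).
  pose proof (Rmax_l B 2 : B <= b). pose proof (Rmax_r B 2 : 2 <= b).
  assert (K := H a b Ha ltac:(lra) ltac:(lra) ltac:(lra)).
  assert (RInt f 1 2 <= RInt f a b).
  { apply RInt_le_extend; auto; try lra.
    intros t Ht; apply Rlt_le; auto. }
  apply Rabs_def2 in K. lra.
Qed.

(** Truncations equal [F b - F a]; differentiability at [0] makes [F] continuous there, which
    settles the lower end. *)
Lemma improper_integral_derive (F f : R -> R) (L : R) :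
  (forall t, is_derive F t (f t)) ->
  (forall t, continuous f t) ->
  (forall eps, 0 < eps -> exists B, forall b, B <= b -> Rabs (F b - L) < eps) ->
  improper_integral_0_inf f (L - F 0).
Proof.
  intros Hd Hc HL.
  assert (HI : forall a b, is_RInt f a b (F b - F a)).
  { intros a b. apply (is_RInt_derive F f); auto. }
  apply improper_integral_RInt; split.
  - intros a b _ _. eexists. apply HI.
  - intros eps He.
    destruct (HL (eps / 2)) as [B HB]; [lra|].
    assert (HF0 : continuity_pt F 0).
    { apply continuity_pt_filterlim. apply @ex_derive_continuous.
      eexists; apply Hd. }
    destruct (HF0 (eps / 2)) as (d & Hd0 & Hd'); [lra|].
    exists d, B; split; [exact Hd0|]. intros a b Ha Had HBb Hab.
    rewrite (is_RInt_unique _ _ _ _ (HI a b)).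
    assert (K1 := HB b HBb).
    assert (K2 : Rabs (F a - F 0) < eps / 2).
    { apply (Hd' a). split.
      - split; [exact I|lra].
      - simpl. unfold Rdist. rewrite Rminus_0_r, Rabs_right; lra. }
    apply Rabs_def2 in K1, K2. apply Rabs_def1; lra.
Qed.

Lemma Gamma_pos (nu : R) : 1 < nu -> 0 < Gamma nu.
Proof.
  intros Hnu. set (f := fun t => Rpower t (nu - 1) * exp (- t)).
  assert (Hc : forall t, 0 < t -> continuous f t).
  { intros t Ht. apply @ex_derive_continuous. unfold f, Rpower.
    auto_derive. exact Ht. }
  assert (Hp : forall t, 0 < t -> 0 < f t).
  { intros t _. apply Rmult_lt_0_compat; apply exp_pos. }
  (* [ln s <= s - 1] at [s = t / (2p)], [p = nu - 1], gives
     [p ln t <= t / 2 + p ln (2p)]. *)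
  destruct (improper_integral_exists f (exp ((nu - 1) * ln (2 * (nu - 1)))))
    as [l Hl]; auto.
  { intros t Ht; apply Rlt_le; auto. }
  { intros t Ht. unfold f, Rpower. rewrite <- !exp_plus.
    assert (Hq : (nu - 1) * ln t + - t <=
                 (nu - 1) * ln (2 * (nu - 1)) + - (t / 2)).
    { set (s := t / (2 * (nu - 1))).
      assert (Hs : 0 < s) by (apply Rdiv_lt_0_compat; lra).
      assert (Ht' : t = 2 * (nu - 1) * s) by (unfold s; field; lra).
      assert (ln s <= s - 1).
      { pose proof (exp_ineq1_le (ln s)) as K. rewrite exp_ln in K; lra. }
      rewrite Ht' at 1. rewrite ln_mult by lra. nra. }
    destruct Hq as [Hq | ->]; [left; now apply exp_increasing|right; reflexivity]. }
  apply (improper_integral_pos f); auto. now apply (Int_0_inf_correct f l).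
Qed.

(** * The Macdonald function *)

Lemma exp_le_compat (x y : R) : x <= y -> exp x <= exp y.
Proof.
  intros [H | ->]; [left; now apply exp_increasing|apply Rle_refl].
Qed.

Lemma cosh_ge_1 (t : R) : 1 <= cosh t.
Proof.
  unfold cosh. pose proof (exp_ineq1_le t). pose proof (exp_ineq1_le (- t)). lra.
Qed.

Lemma cosh_mul (u v : R) : cosh u * cosh v = (cosh (v + u) + cosh (v - u)) / 2.
Proof.
  unfold cosh. replace (- (v + u)) with (- v + - u) by ring.
  replace (- (v - u)) with (- v + u) by ring. unfold Rminus.
  rewrite !exp_plus. field.
Qed.

Lemma sinh_mul (u v : R) : sinh u * sinh v = (cosh (v + u) - cosh (v - u)) / 2.
Proof.
  unfold sinh, cosh. replace (- (v + u)) with (- v + - u) by ring.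
  replace (- (v - u)) with (- v + u) by ring. unfold Rminus.
  rewrite !exp_plus. field.
Qed.

Lemma cosh_le (u v : R) : - v <= u <= v -> cosh u <= cosh v.
Proof.
  intros [H1 H2].
  (* [2 (cosh v - cosh u) = (e^v - e^u) (1 - e^(-u-v))] *)
  assert (K1 : exp u <= exp v) by now apply exp_le_compat.
  assert (K2 : exp (- u) * exp (- v) <= 1).
  { rewrite <- exp_plus, <- exp_0. apply exp_le_compat; lra. }
  assert (K3 : exp u * exp (- u) = 1).
  { rewrite <- exp_plus, <- exp_0. f_equal; ring. }
  assert (K4 : exp v * exp (- v) = 1).
  { rewrite <- exp_plus, <- exp_0. f_equal; ring. }
  unfold cosh.
  assert (0 <= (exp v - exp u) * (1 - exp (- u) * exp (- v))).
  { apply Rmult_le_pos; lra. }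
  assert ((exp v - exp u) * (1 - exp (- u) * exp (- v)) =
          exp v - exp u - exp (- u) * (exp v * exp (- v))
          + exp (- v) * (exp u * exp (- u))) by ring.
  rewrite K3, K4 in *. lra.
Qed.

Definition bessel_kernel (k x t : R) : R := exp (- x * cosh t) * cosh (k * t).

Lemma bessel_kernel_pos (k x t : R) : 0 < bessel_kernel k x t.
Proof.
  apply Rmult_lt_0_compat; [apply exp_pos|].
  pose proof (cosh_ge_1 (k * t)); lra.
Qed.

Lemma bessel_kernel_continuous (k x t : R) : continuous (bessel_kernel k x) t.
Proof.
  apply @ex_derive_continuous. unfold bessel_kernel. auto_derive. easy.
Qed.

(** A quadratic lower bound on [cosh t] makes the first factor Gaussian, which beats the growth
    [exp (Rabs k * t)] of the second. The rate [1 / 2] is the one that [improper_integral_exists]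
    asks for. *)
Lemma bessel_kernel_bound (k x t : R) : 0 < x -> 0 <= t ->
  bessel_kernel k x t <=
  exp (2 * (Rabs k + 1 / 2) ^ 2 / x) * exp (- (t / 2)).
Proof.
  intros Hx Ht. pose proof (Rabs_pos k) as Hk.
  set (K := Rabs k) in *.
  assert (H1 : cosh (k * t) <= exp (K * t)).
  { apply Rle_trans with (cosh (K * t)).
    - apply cosh_le. pose proof (Rle_abs k). pose proof (Rle_abs (- k)) as Hn.
      rewrite Rabs_Ropp in Hn. fold K in H, Hn. nra.
    - unfold cosh. assert (exp (- (K * t)) <= exp (K * t)).
      { apply exp_le_compat. nra. }
      lra. }
  (* Squaring [exp (t / 2) >= 1 + t / 2] gives [exp t >= t ^ 2 / 4], and [cosh t >= exp t / 2]. *)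
  assert (H2 : t ^ 2 / 8 <= cosh t).
  { pose proof (exp_ineq1_le (t / 2)) as E.
    assert (Et : exp t = exp (t / 2) * exp (t / 2)).
    { rewrite <- exp_plus. f_equal; field. }
    unfold cosh. pose proof (exp_pos (- t)). nra. }
  unfold bessel_kernel.
  apply Rle_trans with (exp (- x * (t ^ 2 / 8)) * exp (K * t)).
  { apply Rmult_le_compat; try apply Rlt_le, exp_pos.
    - pose proof (cosh_ge_1 (k * t)); lra.
    - apply exp_le_compat. nra.
    - exact H1. }
  rewrite <- !exp_plus. apply exp_le_compat.
  (* complete the square in [t] *)
  assert (0 <= (x * t / 4 - (K + 1 / 2)) ^ 2 * (2 / x)).
  { apply Rmult_le_pos; [apply pow2_ge_0|].
    apply Rlt_le, Rdiv_lt_0_compat; lra. }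
  assert ((x * t / 4 - (K + 1 / 2)) ^ 2 * (2 / x) =
    x * t ^ 2 / 8 - (K + 1 / 2) * t + 2 * (K + 1 / 2) ^ 2 / x) by (field; lra).
  lra.
Qed.

Lemma BesselK_integral (k x : R) : 0 < x ->
  improper_integral_0_inf (bessel_kernel k x) (BesselK k x).
Proof.
  intros Hx.
  destruct (improper_integral_exists (bessel_kernel k x)
    (exp (2 * (Rabs k + 1 / 2) ^ 2 / x))) as [l Hl].
  - intros t _. apply bessel_kernel_continuous.
  - intros t _. apply Rlt_le, bessel_kernel_pos.
  - intros t Ht. apply bessel_kernel_bound; lra.
  - exact (Int_0_inf_correct _ _ Hl).
Qed.

Lemma BesselK_pos (k x : R) : 0 < x -> 0 < BesselK k x.
Proof.
  intros Hx. apply (improper_integral_pos (bessel_kernel k x)).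
  - intros t _. apply bessel_kernel_continuous.
  - intros t _. apply bessel_kernel_pos.
  - now apply BesselK_integral.
Qed.

Lemma BesselK_le (j k x : R) : - k <= j <= k -> 0 < x ->
  BesselK j x <= BesselK k x.
Proof.
  intros Hjk Hx.
  apply (improper_integral_le (bessel_kernel j x) (bessel_kernel k x));
    try now apply BesselK_integral.
  intros t Ht. apply Rmult_le_compat_l; [apply Rlt_le, exp_pos|].
  apply cosh_le. nra.
Qed.

(* The integrand of the difference is [2 / x] times the derivative of
   [- exp (- x cosh t) sinh (k t)] plus [2 k / x] times the kernel. *)
Lemma BesselK_recurrence (k x : R) : 0 < x ->
  x * (BesselK (k + 1) x - BesselK (k - 1) x) = 2 * k * BesselK k x.
Proof.
  intros Hx.
  set (F := fun t => exp (- x * cosh t) * sinh (k * t)).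
  set (f := fun t => k * bessel_kernel k x t
                     - x * (exp (- x * cosh t) * (sinh t * sinh (k * t)))).
  assert (H0 : improper_integral_0_inf f (0 - F 0)).
  { apply improper_integral_derive.
    - intros t. unfold F, f, bessel_kernel. auto_derive; [easy|ring].
    - intros t. apply @ex_derive_continuous. unfold f, bessel_kernel.
      auto_derive. easy.
    - intros eps He. set (C := exp (2 * (Rabs k + 1 / 2) ^ 2 / x)).
      assert (HC : 0 < C) by apply exp_pos.
      (* Beyond this point [exp (b / 2) >= 1 + b / 2 > C / eps], so the bound [C * exp (- (b / 2))]
         on the boundary term falls below [eps]. *)
      exists (Rmax 0 (2 * (C / eps))). intros b Hb.
      pose proof (Rmax_l 0 (2 * (C / eps))).
      pose proof (Rmax_r 0 (2 * (C / eps))).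
      assert (HF : Rabs (F b) <= C * exp (- (b / 2))).
      { apply Rle_trans with (bessel_kernel k x b);
          [|apply bessel_kernel_bound; lra].
        unfold F, bessel_kernel. rewrite Rabs_mult, Rabs_right
          by apply Rle_ge, Rlt_le, exp_pos.
        apply Rmult_le_compat_l; [apply Rlt_le, exp_pos|].
        unfold sinh, cosh. pose proof (exp_pos (k * b)).
        pose proof (exp_pos (- (k * b))). apply Rabs_le; lra. }
      rewrite Rminus_0_r. apply Rle_lt_trans with (1 := HF).
      rewrite exp_Ropp. pose proof (exp_ineq1_le (b / 2)) as E.
      apply Rmult_lt_reg_r with (exp (b / 2)); [apply exp_pos|].
      rewrite Rmult_assoc, Rinv_l, Rmult_1_r
        by apply Rgt_not_eq, exp_pos.
      assert (C = eps * (C / eps)) by (field; lra). nra. }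
  assert (HF0 : F 0 = 0).
  { unfold F. rewrite Rmult_0_r, sinh_0. ring. }
  rewrite HF0, Rminus_0_r in H0.
  assert (H1 : improper_integral_0_inf
    (fun t => bessel_kernel (k + 1) x t - bessel_kernel (k - 1) x t)
    (1 * BesselK (k + 1) x + (-1) * BesselK (k - 1) x)).
  { apply (improper_integral_lin (bessel_kernel (k + 1) x)
      (bessel_kernel (k - 1) x)); try now apply BesselK_integral.
    intros t _; ring. }
  (* Second evaluation of the same integral: the product formula for [sinh] splits it into kernels
     of orders [k], [k + 1], [k - 1]. Uniqueness equates the result with [0]. *)
  assert (H2 : improper_integral_0_inf f
    (k * BesselK k x
     + (- x / 2) * (1 * BesselK (k + 1) x + (-1) * BesselK (k - 1) x))).
  { eapply improper_integral_lin; [now apply BesselK_integral|exact H1|].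
    intros t _. unfold f. rewrite sinh_mul. unfold bessel_kernel.
    replace ((k + 1) * t) with (k * t + t) by ring.
    replace ((k - 1) * t) with (k * t - t) by ring. field. }
  pose proof (improper_integral_unique _ _ _ H0 H2). lra.
Qed.

(** * Differentiation under the integral sign *)

Lemma exp_taylor1_bound (u : R) : Rabs (exp u - 1 - u) <= u ^ 2 * exp (Rabs u).
Proof.
  pose proof (exp_ineq1_le u) as E1. pose proof (exp_ineq1_le (- u)) as E2.
  pose proof (exp_pos u).
  assert (E3 : exp u * exp (- u) = 1).
  { rewrite <- exp_plus, <- exp_0. f_equal; ring. }
  assert (E4 : exp u - 1 <= u * exp u) by nra.
  (* So far [0 <= exp u - 1 - u <= u * (exp u - 1)]. The last factor is at most [u * exp u] for
     [u >= 0] and lies between [u] and [0] for [u < 0]. *)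
  rewrite Rabs_right by lra.
  destruct (Rle_dec 0 u) as [Hu | Hu].
  - rewrite Rabs_right by lra. nra.
  - rewrite Rabs_left by lra. assert (1 <= exp (- u)) by lra. nra.
Qed.

(** Taylor remainder with a majorant whose only dependence on [h] is the factor [h ^ 2]: for
    [Rabs h <= x / 2] the loss [exp (Rabs h * cosh t)] is absorbed by halving [x] in the kernel. *)
Lemma bessel_kernel_taylor1 (k x h t : R) : Rabs h <= x / 2 ->
  Rabs (bessel_kernel k (x + h) t - bessel_kernel k x t
        + h * (cosh t * bessel_kernel k x t)) <=
  h ^ 2 * (cosh t * (cosh t * bessel_kernel k (x / 2) t)).
Proof.
  intros Hh. unfold bessel_kernel.
  pose proof (cosh_ge_1 t) as Hc. pose proof (cosh_ge_1 (k * t)) as Hck.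
  set (c := cosh t) in *. set (d := cosh (k * t)) in *.
  assert (E : exp (- (x + h) * c) = exp (- x * c) * exp (- h * c)).
  { rewrite <- exp_plus. f_equal; ring. }
  rewrite E.
  replace (exp (- x * c) * exp (- h * c) * d - exp (- x * c) * d
    + h * (c * (exp (- x * c) * d)))
    with (exp (- x * c) * d * (exp (- h * c) - 1 - (- h * c))) by ring.
  rewrite Rabs_mult, (Rabs_right (exp (- x * c) * d)).
  2: { apply Rle_ge, Rmult_le_pos; [apply Rlt_le, exp_pos|lra]. }
  apply Rle_trans with
    (exp (- x * c) * d * ((- h * c) ^ 2 * exp (Rabs (- h * c)))).
  { apply Rmult_le_compat_l; [|apply exp_taylor1_bound].
    apply Rmult_le_pos; [apply Rlt_le, exp_pos|lra]. }
  replace (exp (- x * c) * d * ((- h * c) ^ 2 * exp (Rabs (- h * c)))) with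
    (h ^ 2 * (c * (c * ((exp (- x * c) * exp (Rabs (- h * c))) * d)))) by ring.
  apply Rmult_le_compat_l; [apply pow2_ge_0|].
  do 2 (apply Rmult_le_compat_l; [lra|]).
  apply Rmult_le_compat_r; [lra|].
  rewrite <- exp_plus. apply exp_le_compat.
  rewrite Rabs_mult, Rabs_Ropp, (Rabs_right c) by lra. nra.
Qed.

(** A weight [cosh t] only shifts the order, so weighted kernels integrate to Macdonald functions
    again. *)
Lemma cosh_mul_bessel_kernel (k x t : R) :
  cosh t * bessel_kernel k x t =
  1 / 2 * bessel_kernel (k + 1) x t + 1 / 2 * bessel_kernel (k - 1) x t.
Proof.
  unfold bessel_kernel.
  replace ((k + 1) * t) with (k * t + t) by ring.
  replace ((k - 1) * t) with (k * t - t) by ring.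
  transitivity (exp (- x * cosh t) * (cosh t * cosh (k * t))); [ring|].
  rewrite cosh_mul. field.
Qed.

Lemma cosh_bessel_kernel_integral (k x : R) : 0 < x ->
  improper_integral_0_inf (fun t => cosh t * bessel_kernel k x t)
    (1 / 2 * BesselK (k + 1) x + 1 / 2 * BesselK (k - 1) x).
Proof.
  intros Hx. apply (improper_integral_lin (bessel_kernel (k + 1) x)
    (bessel_kernel (k - 1) x)); try now apply BesselK_integral.
  intros t _. apply cosh_mul_bessel_kernel.
Qed.

(** Integrating [bessel_kernel_taylor1] bounds the first-order remainder by [h ^ 2 * M], where [M]
    is the integral of the majorant. *)
Lemma derivable_pt_lim_BesselK_avg (k x : R) : 0 < x ->
  derivable_pt_lim (BesselK k) x
    (- (1 / 2 * BesselK (k + 1) x + 1 / 2 * BesselK (k - 1) x)).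
Proof.
  intros Hx.
  set (L := 1 / 2 * BesselK (k + 1) x + 1 / 2 * BesselK (k - 1) x).
  assert (HM : exists M, improper_integral_0_inf
    (fun t => cosh t * (cosh t * bessel_kernel k (x / 2) t)) M).
  { eexists. apply (improper_integral_lin
      (fun t => cosh t * bessel_kernel (k + 1) (x / 2) t)
      (fun t => cosh t * bessel_kernel (k - 1) (x / 2) t) _ (1 / 2) (1 / 2));
      try (apply cosh_bessel_kernel_integral; lra).
    intros t _. rewrite cosh_mul_bessel_kernel. ring. }
  destruct HM as [M HM].
  assert (HMs : forall c, improper_integral_0_inf
    (fun t => c * (cosh t * (cosh t * bessel_kernel k (x / 2) t))) (c * M)).
  { intros c. replace (c * M) with (c * M + 0 * M) by ring.
    eapply improper_integral_lin; [exact HM|exact HM|intros; cbv beta; ring]. }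
  assert (Hbound : forall h, Rabs h <= x / 2 ->
    Rabs (BesselK k (x + h) - BesselK k x + h * L) <= h ^ 2 * M).
  { intros h Hh.
    assert (Hxh : 0 < x + h).
    { pose proof (Rle_abs (- h)) as K. rewrite Rabs_Ropp in K. lra. }
    assert (HD : improper_integral_0_inf
      (fun t => bessel_kernel k (x + h) t - bessel_kernel k x t
        + h * (cosh t * bessel_kernel k x t))
      (1 * (1 * BesselK k (x + h) + (-1) * BesselK k x) + h * L)).
    { apply (improper_integral_lin
        (fun t => bessel_kernel k (x + h) t - bessel_kernel k x t)
        (fun t => cosh t * bessel_kernel k x t)).
      - apply (improper_integral_lin (bessel_kernel k (x + h))
          (bessel_kernel k x)); try now apply BesselK_integral.
        intros; ring.
      - now apply cosh_bessel_kernel_integral.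
      - intros; ring. }
    replace (BesselK k (x + h) - BesselK k x + h * L) with
      (1 * (1 * BesselK k (x + h) + (-1) * BesselK k x) + h * L) by ring.
    assert (HT := fun t => bessel_kernel_taylor1 k x h t Hh).
    apply Rabs_le; split.
    - rewrite Ropp_mult_distr_l.
      apply (improper_integral_le _ _ _ _ (HMs (- h ^ 2)) HD).
      intros t _. specialize (HT t). apply Rabs_le_between in HT. lra.
    - apply (improper_integral_le _ _ _ _ HD (HMs (h ^ 2))).
      intros t _. specialize (HT t). apply Rabs_le_between in HT. lra. }
  assert (HM0 : 0 <= M).
  { pose proof (Hbound (x / 2)) as K. rewrite Rabs_right in K by lra.
    specialize (K (Rle_refl _)).
    pose proof (Rabs_pos (BesselK k (x + x / 2) - BesselK k x + x / 2 * L)).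
    assert (0 < (x / 2) ^ 2) by (apply pow_lt; lra). nra. }
  intros eps He.
  (* The bound [x / 2] keeps [Hbound] applicable; [M + 1] instead of [M] covers [M = 0] and gives a
     strict inequality. *)
  assert (Hd : 0 < Rmin (x / 2) (eps / (M + 1))).
  { apply Rmin_glb_lt; [lra|apply Rdiv_lt_0_compat; lra]. }
  exists (mkposreal _ Hd). intros h Hh0 Hh. simpl in Hh.
  pose proof (Rmin_l (x / 2) (eps / (M + 1))).
  pose proof (Rmin_r (x / 2) (eps / (M + 1))).
  assert (Hb := Hbound h ltac:(lra)).
  replace ((BesselK k (x + h) - BesselK k x) / h - - L) with
    ((BesselK k (x + h) - BesselK k x + h * L) / h) by (field; exact Hh0).
  rewrite Rabs_div by exact Hh0.
  pose proof (Rabs_pos_lt h Hh0) as Hp.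
  apply Rmult_lt_reg_r with (Rabs h); [exact Hp|].
  unfold Rdiv. rewrite Rmult_assoc, Rinv_l, Rmult_1_r by lra.
  rewrite <- (pow2_abs h) in Hb.
  assert (Rabs h * (M + 1) < eps).
  { apply Rmult_lt_reg_r with (/ (M + 1)); [apply Rinv_0_lt_compat; lra|].
    rewrite Rmult_assoc, Rinv_r, Rmult_1_r by lra. fold (Rdiv eps (M + 1)). lra. }
  nra.
Qed.

(** The recurrence eliminates order [nu + 1]. With the companion lemma, which eliminates order
    [nu - 2], the orders [nu] and [nu - 1] are closed under differentiation. *)
Lemma derivable_pt_lim_BesselK_down (nu x : R) : 0 < x ->
  derivable_pt_lim (BesselK nu) x
    (- BesselK (nu - 1) x - nu / x * BesselK nu x).
Proof.
  intros Hx. pose proof (BesselK_recurrence nu x Hx) as K.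
  replace (- BesselK (nu - 1) x - nu / x * BesselK nu x) with
    (- (1 / 2 * BesselK (nu + 1) x + 1 / 2 * BesselK (nu - 1) x)).
  - now apply derivable_pt_lim_BesselK_avg.
  - replace (nu / x * BesselK nu x) with
      (2 * nu * BesselK nu x / (2 * x)) by (field; lra).
    rewrite <- K. field. lra.
Qed.

Lemma derivable_pt_lim_BesselK_up (nu x : R) : 0 < x ->
  derivable_pt_lim (BesselK (nu - 1)) x
    (- BesselK nu x + (nu - 1) / x * BesselK (nu - 1) x).
Proof.
  intros Hx. pose proof (BesselK_recurrence (nu - 1) x Hx) as K.
  replace (nu - 1 + 1) with nu in K by ring.
  replace (- BesselK nu x + (nu - 1) / x * BesselK (nu - 1) x) with
    (- (1 / 2 * BesselK (nu - 1 + 1) x + 1 / 2 * BesselK (nu - 1 - 1) x)).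
  - now apply derivable_pt_lim_BesselK_avg.
  - replace (nu - 1 + 1) with nu by ring.
    replace ((nu - 1) / x * BesselK (nu - 1) x) with
      (2 * (nu - 1) * BesselK (nu - 1) x / (2 * x)) by (field; lra).
    rewrite <- K. field. lra.
Qed.

(** The [nu / x] term cancels against the derivative of the power. The formula yields both the
    derivative of [calK] and the decay bound [BesselK_Rpower_bound]. *)
Lemma derivable_pt_lim_Rpower_BesselK (nu x : R) : 0 < x ->
  derivable_pt_lim (fun y => Rpower y nu * BesselK nu y) x
    (- (Rpower x nu * BesselK (nu - 1) x)).
Proof.
  intros Hx.
  replace (- (Rpower x nu * BesselK (nu - 1) x)) with
    (nu * Rpower x (nu - 1) * BesselK nu x
     + Rpower x nu * (- BesselK (nu - 1) x - nu / x * BesselK nu x)).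
  - apply (derivable_pt_lim_mult (fun y => Rpower y nu)).
    + now apply derivable_pt_lim_power.
    + now apply derivable_pt_lim_BesselK_down.
  - replace (Rpower x nu) with (Rpower x (nu - 1) * x).
    + field. lra.
    + rewrite <- (Rpower_1 x) at 2 by exact Hx. rewrite <- Rpower_plus.
      f_equal; ring.
Qed.

Lemma derivable_pt_lim_calK (nu x : R) : 0 < x ->
  derivable_pt_lim (calK nu) x
    (- (Rpower 2 (nu - 1) * Gamma nu * (Rpower x nu * BesselK (nu - 1) x))).
Proof.
  intros Hx. rewrite Ropp_mult_distr_r.
  apply is_derive_Reals.
  apply (is_derive_ext (fun y => Rpower 2 (nu - 1) * Gamma nu *
    (Rpower y nu * BesselK nu y))).
  - intros y. unfold calK. apply eq_sym, Rmult_assoc.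
  - apply is_derive_Reals.
    apply (derivable_pt_lim_scal (fun y => Rpower y nu * BesselK nu y)).
    now apply derivable_pt_lim_Rpower_BesselK.
Qed.

(** * Log-concavity *)

Lemma decr_of_neg_derive (f f' : R -> R) :
  (forall x, 0 < x -> derivable_pt_lim f x (f' x)) ->
  (forall x, 0 < x -> f' x < 0) ->
  forall x y, 0 < x -> x < y -> f y < f x.
Proof.
  intros Hd Hn x y Hx Hxy.
  destruct (MVT_cor2 f f' x y Hxy) as (c & Hc & Hcxy).
  { intros c Hc. apply Hd; lra. }
  assert (f' c < 0) by (apply Hn; lra). nra.
Qed.

(** The mean value theorem on each side of the intermediate point gives two slopes, and the left one
    is larger because [p] decreases. *)
Lemma strictly_concave_of_decr_derive (h p : R -> R) :
  (forall x, 0 < x -> derivable_pt_lim h x (p x)) ->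
  (forall x y, 0 < x -> x < y -> p y < p x) ->
  forall x y t, 0 < x -> 0 < y -> x <> y -> 0 < t < 1 ->
    t * h x + (1 - t) * h y < h (t * x + (1 - t) * y).
Proof.
  intros Hd Hp.
  assert (W : forall x y t, 0 < x -> x < y -> 0 < t < 1 ->
    t * h x + (1 - t) * h y < h (t * x + (1 - t) * y)).
  { intros x y t Hx Hxy Ht. set (z := t * x + (1 - t) * y).
    assert (Hxz : z - x = (1 - t) * (y - x)) by (unfold z; ring).
    assert (Hzy : y - z = t * (y - x)) by (unfold z; ring).
    assert (x < z) by nra. assert (z < y) by nra.
    destruct (MVT_cor2 h p x z) as (c1 & E1 & H1); [lra| |].
    { intros; apply Hd; lra. }
    destruct (MVT_cor2 h p z y) as (c2 & E2 & H2); [lra| |].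
    { intros; apply Hd; lra. }
    assert (p c2 < p c1) by (apply Hp; lra).
    rewrite Hxz in E1. rewrite Hzy in E2.
    assert (0 < t * (1 - t) * (y - x) * (p c1 - p c2)).
    { repeat apply Rmult_lt_0_compat; lra. }
    assert (t * (h z - h x) - (1 - t) * (h y - h z) =
      t * (1 - t) * (y - x) * (p c1 - p c2)) by (rewrite E1, E2; ring).
    lra. }
  intros x y t Hx Hy Hne Ht.
  destruct (Rtotal_order x y) as [H | [H | H]]; [now apply W|easy|].
  pose proof (W y x (1 - t) Hy H ltac:(lra)) as K.
  replace (1 - (1 - t)) with t in K by ring.
  rewrite (Rplus_comm (t * x)). lra.
Qed.

(** * Sign of the second logarithmic derivative *)

(* [- bessel_defect nu x / (x * BesselK (nu - 1) x ^ 2)] is the second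
   derivative of [ln (x ^ nu * BesselK (nu - 1) x)]. *)
Definition bessel_defect (nu x : R) : R :=
  x * BesselK nu x ^ 2 - x * BesselK (nu - 1) x ^ 2
  - (2 * nu - 1) * (BesselK nu x * BesselK (nu - 1) x)
  + (2 * nu - 1) * (BesselK (nu - 1) x ^ 2 / x).

Lemma derivable_pt_lim_bessel_defect (nu x : R) : 0 < x ->
  derivable_pt_lim (bessel_defect nu) x
    (- ((2 * nu - 1) * BesselK (nu - 1) x / x ^ 2 *
        (x * BesselK nu x - (2 * nu - 3) * BesselK (nu - 1) x))).
Proof.
  intros Hx.
  pose proof (derivable_pt_lim_BesselK_down nu x Hx) as HA.
  pose proof (derivable_pt_lim_BesselK_up nu x Hx) as HB.
  apply is_derive_Reals in HA, HB. apply is_derive_Reals.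
  pose proof (is_derive_unique _ _ _ HA) as EA.
  pose proof (is_derive_unique _ _ _ HB) as EB.
  unfold bessel_defect.
  auto_derive.
  - repeat split; try (eexists; eassumption); lra.
  - change (fun x => BesselK nu x) with (BesselK nu).
    change (fun x => BesselK (nu - 1) x) with (BesselK (nu - 1)).
    rewrite EA, EB. field. lra.
Qed.

Lemma bessel_defect_decr (nu x y : R) : 1 / 2 < nu -> 0 < x -> x < y ->
  bessel_defect nu y < bessel_defect nu x.
Proof.
  intros Hnu. apply (decr_of_neg_derive _ _ (derivable_pt_lim_bessel_defect nu)).
  clear x y. intros x Hx.
  pose proof (BesselK_pos (nu - 1) x Hx) as HB.
  pose proof (BesselK_pos (nu - 1 - 1) x Hx) as HC.
  (* By the recurrence, the bracket in the derivative equals [x * BesselK (nu - 2) x + BesselK (nu -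
     1) x], a sum of positive terms. *)
  pose proof (BesselK_recurrence (nu - 1) x Hx) as K.
  replace (nu - 1 + 1) with nu in K by ring.
  assert (0 < (2 * nu - 1) * BesselK (nu - 1) x / x ^ 2 *
        (x * BesselK nu x - (2 * nu - 3) * BesselK (nu - 1) x)); [|lra].
  apply Rmult_lt_0_compat.
  - apply Rdiv_lt_0_compat; [|now apply pow_lt].
    apply Rmult_lt_0_compat; lra.
  - nra.
Qed.

(** The function [Rpower x nu * BesselK nu x] decreases, so it is compared with its value at [1].
    This polynomial decay suffices to send the defect to [0]. *)
Lemma BesselK_Rpower_bound (nu x : R) : 1 <= x ->
  BesselK nu x <= BesselK nu 1 * Rpower x (- nu).
Proof.
  intros Hx.
  assert (K : Rpower x nu * BesselK nu x <= BesselK nu 1).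
  { destruct Hx as [Hx | <-].
    - left. replace (BesselK nu 1) with (Rpower 1 nu * BesselK nu 1).
      + apply (decr_of_neg_derive _ _ (derivable_pt_lim_Rpower_BesselK nu));
          try lra.
        intros y Hy. pose proof (BesselK_pos (nu - 1) y Hy).
        assert (0 < Rpower y nu) by apply exp_pos. nra.
      + unfold Rpower. rewrite ln_1, Rmult_0_r, exp_0. ring.
    - right. unfold Rpower. rewrite ln_1, Rmult_0_r, exp_0. ring. }
  rewrite Rpower_Ropp.
  assert (0 < Rpower x nu) by apply exp_pos.
  apply Rmult_le_reg_r with (Rpower x nu); [easy|].
  rewrite Rmult_assoc, Rinv_l, Rmult_1_r by lra. lra.
Qed.

(** For [nu > 1 / 2] one has [- nu <= nu - 1 <= nu], hence [BesselK (nu - 1) x <= BesselK nu x].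
    Only the mixed product can then be negative. *)
Lemma bessel_defect_ge (nu x : R) : 1 / 2 < nu -> 0 < x ->
  - ((2 * nu - 1) * BesselK nu x ^ 2) <= bessel_defect nu x.
Proof.
  intros Hnu Hx. unfold bessel_defect.
  pose proof (BesselK_pos (nu - 1) x Hx) as HB.
  pose proof (BesselK_le (nu - 1) nu x ltac:(lra) Hx) as HAB.
  assert (0 <= BesselK (nu - 1) x ^ 2 / x).
  { apply Rlt_le, Rdiv_lt_0_compat; [now apply pow_lt|lra]. }
  assert (BesselK (nu - 1) x ^ 2 <= BesselK nu x ^ 2) by nra.
  assert (BesselK nu x * BesselK (nu - 1) x <= BesselK nu x ^ 2) by nra.
  nra.
Qed.

(* The defect decreases to its limit [0] at infinity. *)
Lemma bessel_defect_pos (nu x : R) : 1 / 2 < nu -> 0 < x ->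
  0 < bessel_defect nu x.
Proof.
  intros Hnu Hx.
  assert (H0 : forall y, 0 < y -> 0 <= bessel_defect nu y).
  { intros y Hy. apply Rnot_lt_le; intros Hlt.
    set (K1 := BesselK nu 1).
    assert (HK1 : 0 < K1) by (apply BesselK_pos; lra).
    (* Chosen so that [Rpower z (- nu) ^ 2 <= q] forces [bessel_defect nu z >= bessel_defect nu y],
       against strict decrease since [z > y]. *)
    set (q := - bessel_defect nu y / ((2 * nu - 1) * K1 ^ 2)).
    assert (Hden : 0 < (2 * nu - 1) * K1 ^ 2).
    { apply Rmult_lt_0_compat; [lra|now apply pow_lt]. }
    assert (Hq : 0 < q) by (apply Rdiv_lt_0_compat; lra).
    set (z := Rmax (y + 1) (Rmax 1 (/ q))).
    pose proof (Rmax_l (y + 1) (Rmax 1 (/ q)) : y + 1 <= z).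
    pose proof (Rmax_r (y + 1) (Rmax 1 (/ q)) : Rmax 1 (/ q) <= z).
    pose proof (Rmax_l 1 (/ q)). pose proof (Rmax_r 1 (/ q)).
    pose proof (bessel_defect_decr nu y z Hnu Hy ltac:(lra)) as D1.
    pose proof (bessel_defect_ge nu z Hnu ltac:(lra)) as D2.
    pose proof (BesselK_Rpower_bound nu z ltac:(lra)) as D3.
    fold K1 in D3.
    pose proof (BesselK_pos nu z ltac:(lra)) as D4.
    (* Since [2 * nu > 1] and [z >= 1], the left side is at most [/ z], and [z >= / q]. *)
    assert (D5 : Rpower z (- nu) ^ 2 <= q).
    { simpl. rewrite Rmult_1_r, <- Rpower_plus.
      apply Rle_trans with (Rpower z (- (1))).
      - apply Rle_Rpower; lra.
      - rewrite Rpower_Ropp, Rpower_1 by lra.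
        rewrite <- (Rinv_inv q). apply Rinv_le_contravar; [|lra].
        now apply Rinv_0_lt_compat. }
    assert (D6 : BesselK nu z ^ 2 <= K1 ^ 2 * q).
    { apply Rle_trans with ((K1 * Rpower z (- nu)) ^ 2).
      - apply pow_incr; lra.
      - rewrite Rpow_mult_distr. apply Rmult_le_compat_l; [|easy].
        apply pow2_ge_0. }
    assert (D7 : (2 * nu - 1) * (K1 ^ 2 * q) = - bessel_defect nu y).
    { unfold q. field. split; lra. }
    nra. }
  (* Strict decrease turns nonnegativity at [x + 1] into positivity at [x]. *)
  pose proof (bessel_defect_decr nu x (x + 1) Hnu Hx ltac:(lra)).
  pose proof (H0 (x + 1) ltac:(lra)). lra.
Qed.

(** The compared expression is the derivative of [ln (Rpower x nu * BesselK (nu - 1) x)]: the power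
    gives [nu / x] and [derivable_pt_lim_BesselK_up] gives the rest. *)
Lemma log_derivative_decr (nu x y : R) : 1 / 2 < nu -> 0 < x -> x < y ->
  (2 * nu - 1) / y - BesselK nu y / BesselK (nu - 1) y <
  (2 * nu - 1) / x - BesselK nu x / BesselK (nu - 1) x.
Proof.
  intros Hnu.
  apply (decr_of_neg_derive
    (fun y => (2 * nu - 1) / y - BesselK nu y / BesselK (nu - 1) y)
    (fun y => - (bessel_defect nu y / (y * BesselK (nu - 1) y ^ 2)))).
  - clear x y. intros x Hx.
    pose proof (BesselK_pos (nu - 1) x Hx) as HB0.
    pose proof (derivable_pt_lim_BesselK_down nu x Hx) as HA.
    pose proof (derivable_pt_lim_BesselK_up nu x Hx) as HB.
    apply is_derive_Reals in HA, HB. apply is_derive_Reals.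
    pose proof (is_derive_unique _ _ _ HA) as EA.
    pose proof (is_derive_unique _ _ _ HB) as EB.
    auto_derive.
    + repeat split; try (eexists; eassumption); lra.
    + change (fun x => BesselK nu x) with (BesselK nu).
      change (fun x => BesselK (nu - 1) x) with (BesselK (nu - 1)).
      rewrite EA, EB. unfold bessel_defect. field. split; lra.
  - clear x y. intros x Hx.
    pose proof (BesselK_pos (nu - 1) x Hx) as HB0.
    assert (0 < bessel_defect nu x / (x * BesselK (nu - 1) x ^ 2)); [|lra].
    apply Rdiv_lt_0_compat; [now apply bessel_defect_pos|].
    apply Rmult_lt_0_compat; [easy|now apply pow_lt].
Qed.

Lemma strictly_log_concave_Rpower_BesselK (nu c : R) : 1 / 2 < nu -> 0 < c ->
  strictly_log_concave_pos (fun x => c * (Rpower x nu * BesselK (nu - 1) x)).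
Proof.
  intros Hnu Hc.
  assert (Hpos : forall x, 0 < x ->
    0 < c * (Rpower x nu * BesselK (nu - 1) x)).
  { intros x Hx. repeat apply Rmult_lt_0_compat;
      [easy|apply exp_pos|now apply BesselK_pos]. }
  split; [exact Hpos|].
  apply (strictly_concave_of_decr_derive
    (fun x => ln (c * (Rpower x nu * BesselK (nu - 1) x)))
    (fun x => (2 * nu - 1) / x - BesselK nu x / BesselK (nu - 1) x)).
  - intros x Hx. pose proof (Hpos x Hx) as Hp.
    pose proof (BesselK_pos (nu - 1) x Hx) as HB0.
    pose proof (derivable_pt_lim_BesselK_up nu x Hx) as HB.
    apply is_derive_Reals in HB. apply is_derive_Reals.
    pose proof (is_derive_unique _ _ _ HB) as EB.
    unfold Rpower in *.
    auto_derive.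
    + repeat split; try (eexists; eassumption); lra.
    + change (fun x => BesselK (nu - 1) x) with (BesselK (nu - 1)).
      rewrite EB. field. repeat split; try lra. apply Rgt_not_eq, exp_pos.
  - intros x y. now apply log_derivative_decr.
Qed.

Lemma strictly_log_concave_pos_ext (f g : R -> R) :
  (forall x, 0 < x -> f x = g x) ->
  strictly_log_concave_pos f -> strictly_log_concave_pos g.
Proof.
  intros Hfg [Hp Hc]. split.
  - intros x Hx. rewrite <- Hfg by exact Hx. now apply Hp.
  - intros x y t Hx Hy Hne Ht.
    rewrite <- !Hfg by (try assumption; nra). now apply Hc.
Qed.

Theorem theorem3 (nu : R) (hnu : 3 / 2 <= nu) :
  (forall x, 0 < x -> exists l, derivable_pt_lim (calK nu) x l) /\
  (forall g : R -> R,
     (forall x, 0 < x -> derivable_pt_lim (calK nu) x (- g x)) ->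
     strictly_log_concave_pos g).
Proof.
  split.
  - intros x Hx. eexists. now apply derivable_pt_lim_calK.
  - intros g Hg.
    (* Uniqueness of derivatives identifies [g] with the explicit formula on the positive half-line,
       which is all that log-concavity there sees. *)
    apply (strictly_log_concave_pos_ext (fun x =>
      Rpower 2 (nu - 1) * Gamma nu * (Rpower x nu * BesselK (nu - 1) x))).
    + intros x Hx. apply Ropp_eq_reg.
      apply (uniqueness_limite (calK nu) x);
        [now apply derivable_pt_lim_calK|now apply Hg].
    + apply strictly_log_concave_Rpower_BesselK; [lra|].
      apply Rmult_lt_0_compat; [apply exp_pos|apply Gamma_pos; lra].
Qed.
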